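(* For every Pierce sequence $\sigma\in\Sigma$ we have $-\tfrac12\le \mathcal{E}^*(\sigma)\le 0$. Consequently, $-\tfrac12<\mathcal{E}(x)\le 0$ for all $x\in I=[0,1]$.
   Context: Let $I=[0,1]$ and $\mathbb{N}_\infty=\mathbb{N}\cup\{\infty\}$ where $\mathbb{N}=\{1,2,3,\dots\}$, with the conventions $\infty+c=\infty$ and $c/\infty=0$ for $c\in\mathbb{R}$; a product of elements of $\mathbb{N}_\infty$ with a factor $\infty$ equals $\infty$. Define $d_1\colon I\to\mathbb{N}_\infty$ and $T\colon I\to I$ by $d_1(x)=\lfloor 1/x\rfloor$, $T(x)=1-d_1(x)\,x$ for $x\neq 0$, and $d_1(0)=\infty$, $T(0)=0$. For $n\in\mathbb{N}$ let $d_n(x)=d_1(T^{n-1}x)$ (the Pierce expansion digits of $x$), and let $s_n(x)=\sum_{k=1}^n\frac{(-1)^{k+1}}{d_1(x)\cdots d_k(x)}$. The error-sum function of Pierce expansions is $\mathcal{E}\colon I\to\mathbb{R}$, $\mathcal{E}(x)=\sum_{n=1}^\infty (x-s_n(x))$ (absolutely and uniformly convergent). Pierce sequences: $\Sigma_0=\{(\infty,\infty,\dots)\}$; for $n\in\mathbb{N}$, $\Sigma_n$ is the set of sequences $(\sigma_1,\dots,\sigma_n,\infty,\infty,\dots)$ with $\sigma_1<\dots<\sigma_n$ in $\mathbb{N}$; $\Sigma_\infty$ is the set of strictly increasing infinite sequences in $\mathbb{N}$; and $\Sigma=\bigcup_{n\ge0}\Sigma_n\cup\Sigma_\infty\subseteq\mathbb{N}_\infty^{\mathbb{N}}$.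 For $\sigma=(\sigma_k)\in\Sigma$ let $\varphi(\sigma)=\sum_{k=1}^\infty\frac{(-1)^{k+1}}{\sigma_1\cdots\sigma_k}$, $\varphi_n(\sigma)=\sum_{k=1}^n\frac{(-1)^{k+1}}{\sigma_1\cdots\sigma_k}$, and $\mathcal{E}^*(\sigma)=\sum_{n=1}^\infty(\varphi(\sigma)-\varphi_n(\sigma))$ (the series converges absolutely and uniformly on $\Sigma$). *)

(* Defs.v *)
From HB Require Import structures.
From mathcomp Require Import all_boot all_order all_algebra.
From mathcomp Require Import all_classical all_reals all_analysis.

Set Implicit Arguments.
Unset Strict Implicit.
Unset Printing Implicit Defensive.

Import Order.TTheory GRing.Theory Num.Theory.
Import numFieldNormedType.Exports.

Local Open Scope classical_set_scope.
Local Open Scope ring_scope.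

(* [None] is the infinite element and [Some n], for n >= 1, the integer n. All
   entries occurring below (digits of points of [0, 1], entries of Pierce
   sequences) are different from [Some 0]. *)
Definition Ninf := option nat.

Definition mulNinf (a b : Ninf) : Ninf :=
  match a, b with
  | Some m, Some n => Some (m * n)%N
  | _, _ => None
  end.

(* [rdiv c a] is c / a, with c / infinity = 0. *)
Definition rdiv (R : realType) (c : R) (a : Ninf) : R :=
  if a is Some n then c / n%:R else 0.

(* Sequences are indexed from 0: [s 0], [s 1], ... are the first, second, ...
   entries, so [prefix_prod s k] is the product of the first k entries and
   [psum R s n] is the sum over k = 1, ..., n of
   (-1)^(k+1) / (product of the first k entries). *)
Definition prefix_prod (s : nat -> Ninf) (k : nat) : Ninf :=
  \big[mulNinf/Some 1%N]_(0 <= j < k) s j.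

Definition psum (R : realType) (s : nat -> Ninf) (n : nat) : R :=
  \sum_(1 <= k < n.+1) rdiv ((-1) ^+ k.+1) (prefix_prod s k).

(* [truncn] is the floor on nonnegative reals. The points of interest are those
   of [0, 1]; values elsewhere are irrelevant. *)
Definition d1 (R : realType) (x : R) : Ninf :=
  if x == 0 then None else Some (Num.truncn (1 / x)).

Definition pierceT (R : realType) (x : R) : R :=
  if d1 x is Some d then 1 - d%:R * x else 0.

(* [digits x k] is the (k+1)-st Pierce digit of x. *)
Definition digits (R : realType) (x : R) (k : nat) : Ninf :=
  d1 (iter k (@pierceT R) x).

Definition pierce_s (R : realType) (n : nat) (x : R) : R :=
  psum R (digits x) n.

Definition errorsum (R : realType) (x : R) : R :=
  \big[+%R/0]_(1 <= n <oo) (x - pierce_s n x).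

Definition Sigma_fin (n : nat) : set (nat -> Ninf) :=
  [set s | exists a : nat -> nat,
    [/\ forall k, (k < n)%N -> (0 < a k)%N,
        forall j k, (j < k)%N -> (k < n)%N -> (a j < a k)%N
      & forall k, s k = if (k < n)%N then Some (a k) else None]].

Definition Sigma_infty : set (nat -> Ninf) :=
  [set s | exists a : nat -> nat,
    [/\ forall k, (0 < a k)%N,
        forall j k, (j < k)%N -> (a j < a k)%N
      & forall k, s k = Some (a k)]].

Definition Sigma : set (nat -> Ninf) :=
  (\bigcup_(n in [set: nat]) Sigma_fin n) `|` Sigma_infty.

Definition phi (R : realType) (s : nat -> Ninf) : R :=
  \big[+%R/0]_(1 <= k <oo) rdiv ((-1) ^+ k.+1) (prefix_prod s k).

Definition errorsum_star (R : realType) (s : nat -> Ninf) : R :=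
  \big[+%R/0]_(1 <= n <oo) (phi R s - psum R s n).

(* Main.v *)
Require Import Defs.
From HB Require Import structures.
From mathcomp Require Import all_boot all_order all_algebra.
From mathcomp Require Import all_classical all_reals all_analysis.
From mathcomp Require Import ring lra.

Import Order.TTheory GRing.Theory Num.Theory.
Import numFieldNormedType.Exports.

Local Open Scope classical_set_scope.
Local Open Scope ring_scope.

(** Why the bounds hold. Put u_n = 1/(s_1 ... s_n), so that phi(s) is the
    alternating series u_1 - u_2 + u_3 - ..., and let
    t_n = (-1)^n (phi(s) - phi_n(s)) be the signed remainder after n terms.

    If no entry after the first equals 1, then u_(n+1) <= u_n / 2 for n >= 1.
    Hence Leibniz' criterion ([alternating_series_remainder]) applies to phi(s)
    and gives 0 <= t_n <= u_(n+1). Moreover t_n + t_(n+1) = u_(n+1), while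
    t_(n+1) <= u_(n+2) <= u_(n+1) / 2; so the remainder t_(n+1) is at most half
    of that sum, that is, t_(n+1) <= t_n. Therefore the error sum
    -t_1 + t_2 - t_3 + ... is itself an alternating series with nonincreasing
    terms tending to 0, and the same criterion yields -t_1 <= E*(s) <= 0
    ([errorsum_star_bounds]).

    It remains to bound t_1. For a Pierce sequence, t_1 <= u_2 <= u_1 / 2 <= 1/2.
    For the digits of x in [0, 1], the recursion defining T gives the exact
    remainder x - s_n(x) = (-1)^n u_n T^n(x) ([pierce_remainder]). Since u_n
    tends to 0, x = phi(digits x), so that E(x) = E*(digits x), and
    t_1 = u_1 T(x) <= T(x) < 1/2: the strictness comes from T(x) < 1/2
    ([pierceT_itv]). That same inequality shows that the digits of x after the
    first differ from 1, so the general bound applies to them directly. *)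

(** * Alternating series *)

(** Induction on the number of terms: what follows the leading term a_n is an
    alternating sum of opposite sign which the induction hypothesis bounds by
    a_(n+1) <= a_n, so it cannot overturn a_n. *)
Lemma alternating_partial_bounds (R : realDomainType) (a : nat -> R) (n m : nat) :
  (forall k, a k.+1 <= a k) -> (forall k, 0 <= a k) ->
  0 <= (-1) ^+ n * (\sum_(n <= k < n + m) (-1) ^+ k * a k) <= a n.
Proof.
move=> a_decr a_ge0; elim: m n => [|m IHm] n.
  by rewrite addn0 big_geq// mulr0 lexx a_ge0.
rewrite big_ltn ?addnS ?ltnS ?leq_addr// mulrDr mulrA -expr2 sqrr_sign mul1r.
have := IHm n.+1; rewrite addSn exprS mulN1r mulNr.
move=> /andP[S_le0 S_ge]; have := a_decr n.
by move=> ?; apply/andP; split; lra.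
Qed.

(** Leibniz' criterion with its error bound. The bound on finite blocks makes
    the partial sums Cauchy, and it passes to the limit. *)
Lemma alternating_series_remainder (R : realType) (a : nat -> R) :
  (forall k, a k.+1 <= a k) -> (forall k, 0 <= a k) -> a @ \oo --> 0 ->
  let S := series (fun k => (-1) ^+ k * a k) in
  cvgn S /\ forall n, 0 <= (-1) ^+ n * (limn S - S n) <= a n.
Proof.
move=> a_decr a_ge0 a_to0 S.
have S_bounds n m : 0 <= (-1) ^+ n * (S (n + m)%N - S n) <= a n.
  by rewrite sub_series_geq ?leq_addr//; exact: alternating_partial_bounds.
have S_cvg : cvgn S.
  apply/cauchy_cvgP/cauchy_exP => e e_gt0.
  have [N _ /(_ N (leqnn N)) /= aN_lt] := cvgr0_norm_lt _ a_to0 _ e_gt0.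
  exists (S N); exists N => // p /= Np.
  have := S_bounds N (p - N)%N; rewrite subnKC// => /andP[D_ge0 D_le].
  rewrite /ball/= distrC (le_lt_trans _ aN_lt)//.
  rewrite -[leLHS](normrMsign N) !ger0_norm//.
split=> // n.
have L_cvg : (fun m => (-1) ^+ n * (S (n + m)%N - S n)) @ \oo
    --> (-1) ^+ n * (limn S - S n).
  apply: cvgMl_tmp; apply: cvgB; last exact: cvg_cst.
  under eq_fun do rewrite addnC.
  by move: S_cvg; rewrite -(cvg_shiftn n S).
rewrite -(cvg_lim _ L_cvg)//; apply/andP; split.
  apply: limr_ge; first by apply/cvg_ex; eexists; exact: L_cvg.
  by near=> m; have /andP[] := S_bounds n m.
apply: limr_le; first by apply/cvg_ex; eexists; exact: L_cvg.
by near=> m; have /andP[] := S_bounds n m.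
Unshelve. all: by end_near. Qed.

Lemma series_from1E (R : realType) (f : nat -> R) :
  cvgn (series (fun n => f n.+1)) ->
  \big[+%R/0]_(1 <= n <oo) f n = limn (series (fun n => f n.+1)).
Proof.
move=> f_cvg; apply: cvg_lim => //.
rewrite -cvg_shiftS/=; under eq_fun do rewrite big_add1/=.
exact: f_cvg.
Qed.

(** * Reciprocals of products in the extended positive integers *)

Lemma mulNinfA : associative mulNinf.
Proof. by move=> [a|] [b|] [c|] //=; rewrite mulnA. Qed.

Lemma mulNinf1n : left_id (Some 1%N) mulNinf.
Proof. by move=> [a|] //=; rewrite mul1n. Qed.

Lemma mulNinfn1 : right_id (Some 1%N) mulNinf.
Proof. by move=> [a|] //=; rewrite muln1. Qed.

HB.instance Definition _ :=
  Monoid.isLaw.Build Ninf (Some 1%N) mulNinf mulNinfA mulNinf1n mulNinfn1.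

Section Rdiv.
Variable R : realType.
Implicit Types (c : R) (a b : Ninf).

Lemma rdivE c a : rdiv c a = c * rdiv 1 a.
Proof. by case: a => [n|]/=; rewrite ?mulr0// mul1r. Qed.

Lemma rdiv_sign n a : rdiv ((-1 : R) ^+ n.+2) a = (-1) ^+ n * rdiv 1 a.
Proof. by rewrite rdivE !exprS mulrA mulrNN !mul1r. Qed.

Lemma rdiv1M a b : rdiv (1 : R) (mulNinf a b) = rdiv 1 a * rdiv 1 b.
Proof.
by case: a b => [m|] [n|]/=; rewrite ?mul0r ?mulr0// !div1r natrM invfM.
Qed.

Lemma rdiv1_ge0 a : 0 <= rdiv (1 : R) a.
Proof. by case: a => [n|]//=; rewrite divr_ge0. Qed.

(** This covers [Some 0] as well, because 1 / 0 = 0 in a field. *)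
Lemma rdiv1_le1 a : rdiv (1 : R) a <= 1.
Proof.
case: a => [[|n]|]//=.
by rewrite div1r invf_le1 ?ltr0n// ler1n.
Qed.

Lemma rdiv1_le_half a : a != Some 1%N -> rdiv (1 : R) a <= 1 / 2.
Proof.
case: a => [[|[|n]]|]//= _; rewrite ?invr0 ?mulr0 ?divr_ge0//.
by rewrite !div1r lef_pV2 ?posrE ?ltr0n// ler_nat.
Qed.

End Rdiv.

Definition recip_prod (R : realType) (s : nat -> Ninf) (n : nat) : R :=
  rdiv 1 (prefix_prod s n).

(** * Error sum of a sequence without entry 1 after the first *)

Section RecipProd.
Variables (R : realType) (s : nat -> Ninf).
Local Notation u := (recip_prod R s).

Lemma recip_prod0 : u 0%N = 1.
Proof. by rewrite /recip_prod /prefix_prod big_geq//= divr1. Qed.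

Lemma recip_prodS n : u n.+1 = u n * rdiv 1 (s n).
Proof. by rewrite /recip_prod /prefix_prod big_nat_recr//= rdiv1M. Qed.

Lemma recip_prod_ge0 n : 0 <= u n.
Proof. exact: rdiv1_ge0. Qed.

Lemma psum_series n : psum R s n = series (fun k => (-1) ^+ k * u k.+1) n.
Proof.
by rewrite /psum big_add1/=; apply: eq_bigr => k _; exact: rdiv_sign.
Qed.

Lemma psumS n : psum R s n.+1 = psum R s n + (-1) ^+ n * u n.+1.
Proof. by rewrite !psum_series seriesSr. Qed.

(** Pierce sequences satisfy this because they increase strictly, and digit
    sequences because T takes values below 1/2; it makes each reciprocal product
    after the first at most half of the preceding one. *)
Hypothesis s_neq1 : forall k, s k.+1 != Some 1%N.

Lemma recip_prod_halves n : u n.+2 <= u n.+1 / 2.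
Proof.
rewrite recip_prodS ler_wpM2l ?recip_prod_ge0//.
by rewrite -[leRHS]div1r rdiv1_le_half.
Qed.

Lemma recip_prod_decr n : u n.+2 <= u n.+1.
Proof. by have := recip_prod_halves n; have := recip_prod_ge0 n.+1; lra. Qed.

Lemma recip_prod_geometric n : u n.+1 <= (1 / 2) ^+ n.
Proof.
elim: n => [|n IHn]; first by rewrite recip_prodS recip_prod0 mul1r rdiv1_le1.
by rewrite exprS; have := recip_prod_halves n; lra.
Qed.

Lemma recip_prod_to0 : u n.+1 @[n --> \oo] --> 0.
Proof.
apply: (squeeze_cvgr (f := cst 0) (h := fun n => (1 / 2 : R) ^+ n)).
- by near=> n; rewrite recip_prod_ge0 recip_prod_geometric.
- exact: cvg_cst.
- by apply: cvg_expr; rewrite ger0_norm; lra.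
Unshelve. all: by end_near. Qed.

(** Leibniz' criterion applied to the series defining phi. *)
Lemma phi_remainder :
  (psum R s @ \oo --> phi R s) /\
  forall n, 0 <= (-1) ^+ n * (phi R s - psum R s n) <= u n.+1.
Proof.
have [S_cvg S_rem] := alternating_series_remainder _ (fun k => u k.+1)
  recip_prod_decr (fun n => recip_prod_ge0 n.+1) recip_prod_to0.
have termE : (fun k => rdiv ((-1) ^+ k.+2) (prefix_prod s k.+1)) =
    (fun k => (-1) ^+ k * u k.+1).
  by apply/funext => k; exact: rdiv_sign.
have psumE : psum R s = series (fun k => (-1) ^+ k * u k.+1).
  by apply/funext => n; exact: psum_series.
by rewrite /phi series_from1E ?termE// psumE.
Qed.

(** The remainders of phi, up to sign, satisfy the hypotheses of Leibniz'
    criterion in their turn; the lower bound is minus the first of them. *)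
Lemma errorsum_star_bounds :
  phi R s - psum R s 1 <= errorsum_star R s <= 0.
Proof.
have [_ rem_bounds] := phi_remainder.
pose t n := (-1) ^+ n * (phi R s - psum R s n).
have tE n : phi R s - psum R s n = (-1) ^+ n * t n.
  by rewrite /t mulrA -expr2 sqrr_sign mul1r.
have t_sum n : t n + t n.+1 = u n.+1.
  rewrite /t psumS exprS mulN1r mulNr -mulrBr.
  have -> : phi R s - psum R s n - (phi R s - (psum R s n + (-1) ^+ n * u n.+1))
    = (-1) ^+ n * u n.+1 by lra.
  by rewrite mulrA -expr2 sqrr_sign mul1r.
have t_decr n : t n.+1 <= t n.
  (* t_(n+1) <= u_(n+2) <= u_(n+1) / 2 = (t_n + t_(n+1)) / 2 *)
  have /andP[_] : 0 <= t n.+1 <= u n.+2 := rem_bounds n.+1.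
  by have := t_sum n; have := recip_prod_halves n; lra.
have t_ge0 n : 0 <= t n by have /andP[] := rem_bounds n.
have t_to0 : t n.+1 @[n --> \oo] --> 0.
  apply: (squeeze_cvgr (f := cst 0) (h := fun n => u n.+1)).
  - near=> n; rewrite t_ge0/= (le_trans (t_decr n))//.
    by have /andP[] := rem_bounds n.
  - exact: cvg_cst.
  - exact: recip_prod_to0.
have [S_cvg S_rem] := alternating_series_remainder _ (fun k => t k.+1)
  (fun n => t_decr n.+1) (fun n => t_ge0 n.+1) t_to0.
have termE : (fun n => phi R s - psum R s n.+1) =
    - (fun n => (-1) ^+ n * t n.+1).
  by apply/funext => n; rewrite tE exprS mulN1r mulNr.
rewrite /errorsum_star series_from1E termE; last first.
  by rewrite is_cvg_seriesN.
rewrite lim_seriesN// tE expr1 mulN1r lerN2 oppr_le0.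
have := S_rem 0%N; rewrite expr0 mul1r /series/= big_geq// subr0.
by rewrite andbC.
Unshelve. all: by end_near. Qed.

End RecipProd.

Lemma Sigma_neq1 (s : nat -> Ninf) : Sigma s -> forall k, s k.+1 != Some 1%N.
Proof.
move=> [[n _ [a [a_gt0 a_incr sE]]]|[a [a_gt0 a_incr sE]]] k; rewrite sE.
  case: ifPn => // kn; apply/eqP => -[ak1].
  have := a_incr k k.+1 (ltnSn k) kn.
  by rewrite ak1 ltnNge a_gt0// ltnW.
apply/eqP => -[ak1]; have := a_incr k k.+1 (ltnSn k).
by rewrite ak1 ltnNge a_gt0.
Qed.

(** * The Pierce map *)

Section PierceMap.
Variable R : realType.
Implicit Types x y : R.

(** With d the first digit, d y <= 1 < (d + 1) y gives 0 <= T(y) < y, which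
    settles y <= 1/2; when y > 1/2, use d >= 1, whence T(y) <= 1 - y < 1/2. *)
Lemma pierceT_itv y : 0 <= y <= 1 -> 0 <= pierceT y < 1 / 2.
Proof.
rewrite /pierceT /d1; have [->|y_neq0] := eqVneq y 0.
  by move=> _; rewrite lexx divr_gt0.
move=> /andP[y_ge0 y_le1].
have y_gt0 : 0 < y by rewrite lt_def y_neq0.
set d := Num.truncn _.
have /andP[d_le d_gt] : d%:R <= 1 / y < d.+1%:R.
  by rewrite truncn_itv// divr_ge0.
have d_ge1 : 1 <= d%:R :> R.
  by rewrite ler1n truncn_gt0 ler_pdivlMr// mul1r.
move: d_le; rewrite ler_pdivlMr// => d_le.
move: d_gt; rewrite ltr_pdivrMr// -natr1 mulrDl mul1r => d_gt.
have : y <= d%:R * y by rewrite ler_peMl.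
by move=> ?; apply/andP; split; lra.
Qed.

(** This form of T(y) = 1 - d_1(y) y also covers y = 0, where 1 / d_1 = 0. *)
Lemma pierceT_invert y : 0 <= y <= 1 -> y = rdiv 1 (d1 y) * (1 - pierceT y).
Proof.
rewrite /pierceT /d1; have [->|y_neq0] := eqVneq y 0; first by rewrite mul0r.
move=> /andP[y_ge0 y_le1].
have d_gt0 : (0 < Num.truncn (1 / y))%N.
  by rewrite truncn_gt0 ler_pdivlMr ?mul1r// lt_def y_neq0.
rewrite /=; move: (Num.truncn _) d_gt0 => d d_gt0.
rewrite opprB addrC subrK mulrA div1r mulVf ?mul1r//.
by rewrite pnatr_eq0 -lt0n.
Qed.

Lemma iter_pierceT_itv x k : 0 <= x <= 1 -> 0 <= iter k (@pierceT R) x <= 1.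
Proof.
move=> x01; elim: k => [//|k /pierceT_itv /andP[/= -> /ltW T_le]].
by rewrite (le_trans T_le)//; lra.
Qed.

Lemma d1_neq1 y : 0 <= y < 1 / 2 -> d1 y != Some 1%N.
Proof.
move=> /andP[y_ge0 y_lt]; rewrite /d1; case: (eqVneq y 0) => // y_neq0.
have y_gt0 : 0 < y by rewrite lt_def y_neq0.
apply/eqP => -[d1E]; have /andP[_] := truncn_itv (divr_ge0 ler01 y_ge0).
by rewrite d1E ltr_pdivrMr//; lra.
Qed.

Lemma digits_neq1 x : 0 <= x <= 1 -> forall k, digits x k.+1 != Some 1%N.
Proof. by move=> x01 k; apply/d1_neq1/pierceT_itv/iter_pierceT_itv. Qed.

(** Unfolding one more digit replaces T^n(x) = y by (1 - T(y)) / d_1(y): the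
    first part is the new term of the sum, the second the new remainder. *)
Lemma pierce_remainder x n : 0 <= x <= 1 ->
  x - psum R (digits x) n =
  (-1) ^+ n * (recip_prod R (digits x) n * iter n (@pierceT R) x).
Proof.
move=> x01; elim: n => [|n IHn].
  by rewrite psum_series /series/= big_geq// subr0 recip_prod0 !mul1r.
rewrite psumS opprD addrA IHn recip_prodS iterS /digits.
rewrite {1}(pierceT_invert _ (iter_pierceT_itv x n x01)).
set r := rdiv _ _; set e := (-1) ^+ n; set v := recip_prod _ _ _.
by rewrite exprS -/e; ring.
Qed.

Lemma phi_digits x : 0 <= x <= 1 -> phi R (digits x) = x.
Proof.
move=> x01; have [psum_cvg _] := phi_remainder R _ (digits_neq1 x x01).
rewrite -[LHS](cvg_lim _ psum_cvg)//; apply: cvg_lim => //.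
rewrite -cvg_shiftS/=; apply/cvgrPdist_le => e e_gt0.
have : \forall n \near \oo, `|recip_prod R (digits x) n.+1| <= e.
  exact: cvgr0_norm_le (recip_prod_to0 R _ (digits_neq1 x x01)) _ e_gt0.
apply: filterS => n; apply: le_trans.
rewrite pierce_remainder// !normrM normrX normrN1 expr1n mul1r ler_piMr//.
by have /andP[T_ge0 T_le1] := iter_pierceT_itv x n.+1 x01; rewrite ger0_norm.
Qed.

End PierceMap.

(** * Bounds on the error sums *)

Theorem theorem3p14 (R : realType) :
  (forall s : nat -> Ninf, Sigma s ->
     - (1 / 2) <= errorsum_star R s <= 0) /\
  (forall x : R, 0 <= x <= 1 -> - (1 / 2) < errorsum x <= 0).
Proof.
split=> [s /Sigma_neq1 s_neq1|x x01].
  have /andP[E_ge ->] := errorsum_star_bounds R s s_neq1; rewrite andbT.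
  have [_ /(_ 1%N)] := phi_remainder R s s_neq1.
  rewrite expr1 mulN1r => /andP[_ r_le].
  have := recip_prod_halves R s s_neq1 0.
  have := recip_prod_geometric R s s_neq1 0; rewrite expr0.
  by lra.
have /andP[E_ge E_le] := errorsum_star_bounds R _ (digits_neq1 R x x01).
have -> : errorsum x = errorsum_star R (digits x).
  by rewrite /errorsum_star phi_digits.
rewrite E_le andbT (lt_le_trans _ E_ge)// phi_digits//.
rewrite pierce_remainder// expr1 mulN1r ltrN2/=.
have /andP[T_ge0 T_lt] := pierceT_itv R x x01.
apply: le_lt_trans T_lt; rewrite ler_piMl//.
by rewrite recip_prodS recip_prod0 mul1r rdiv1_le1.
Qed.
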